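(* If $X$ is a Hausdorff space with no isolated points, then there exists a space $sX$ that satisfies the following conditions: (1) $sX$ is an extremally disconnected zero-dimensional Hausdorff space without isolated points (consequently, $sX$ is SHD); (2) $|X|=|sX|$, $\pi w(X)=\pi w(sX)$ and $c(X)=c(sX)$.
   Context: A topological space $X$ is selectively highly divergent (SHD) if for every sequence $(U_n)_{n\in\omega}$ of non-empty open subsets of $X$ one can choose points $x_n\in U_n$ such that the sequence $(x_n)$ has no convergent subsequence. A space is extremally disconnected if the closure of every open set is open, and zero-dimensional if it has a base of clopen sets. $\pi w(X)$ denotes the $\pi$-weight of $X$ (the least cardinality of a $\pi$-base, i.e. of a family of non-empty open sets such that every non-empty open set contains a member of it) and $c(X)$ the cellularity of $X$ (the supremum of the cardinalities of families of pairwise disjoint non-empty open sets); as usual, cardinal functions are taken to be at least $\omega$. *)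

(* Defs.v *)
From mathcomp Require Import all_boot all_classical.
From mathcomp Require Export topology.

Set Implicit Arguments.
Unset Strict Implicit.
Unset Printing Implicit Defensive.

Local Open Scope classical_set_scope.
Local Open Scope card_scope.

Definition no_isolated_points (X : topologicalType) : Prop :=
  isolated [set: X] = set0.

Definition extremally_disconnected (X : topologicalType) : Prop :=
  forall U : set X, open U -> open (closure U).

(* The library's [zero_dimensional] only says that distinct points are
   separated by clopen sets, which is weaker than having a clopen base. *)
Definition has_clopen_base (X : topologicalType) : Prop :=
  exists2 B : set (set X), basis B & B `<=` clopen.

Definition has_convergent_subsequence (X : topologicalType) (x : nat -> X) :
    Prop :=
  exists f : nat -> nat, {homo f : m n / m < n} /\
    exists l : X, x (f n) @[n --> \oo] --> l.

Definition selectively_highly_divergent (X : topologicalType) : Prop :=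
  forall U : nat -> set X, (forall n, open (U n) /\ U n !=set0) ->
    exists x : nat -> X, (forall n, U n (x n)) /\
      ~ has_convergent_subsequence x.

Definition pi_base (X : topologicalType) (B : set (set X)) : Prop :=
  (forall U, B U -> open U /\ U !=set0) /\
  forall V : set X, open V -> V !=set0 -> exists2 U, B U & U `<=` V.

Definition cellular_family (X : topologicalType) (C : set (set X)) : Prop :=
  (forall U, C U -> open U /\ U !=set0) /\ trivIset C id.

(* There is no type of cardinals, so a cardinal is represented by a type [K],
   up to equipotence, and a cardinal function by its graph. *)
Definition infinite_card_ub T (F : set (set T)) (K : Type) : Prop :=
  [set: nat] #<= [set: K] /\ forall A, F A -> A #<= [set: K].

(* [K] is the supremum of omega and the cardinalities of the members of [F]. *)
Definition infinite_card_sup T (F : set (set T)) (K : Type) : Prop :=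
  infinite_card_ub F K /\
  forall L : Type, infinite_card_ub F L -> [set: K] #<= [set: L].

Lemma infinite_card_sup_unique T (F : set (set T)) (K L : Type) :
  infinite_card_sup F K -> infinite_card_sup F L -> [set: K] #= [set: L].
Proof.
by move=> [ubK leK] [ubL leL]; rewrite card_eq_le leK// leL.
Qed.

Definition is_pi_weight (X : topologicalType) (K : Type) : Prop :=
  exists B : set (set X), [/\ pi_base B,
    forall B' : set (set X), pi_base B' -> B #<= B' &
    infinite_card_sup [set B] K].

Definition is_cellularity (X : topologicalType) (K : Type) : Prop :=
  infinite_card_sup (@cellular_family X) K.

(* Main.v *)
(* For every point y of a space Y choose an ultrafilter containing the
   neighbourhoods of y and all dense open sets. Its open members form a point
   of the absolute of Y, so Y becomes a dense subspace sY of the absolute, with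
   base the sets U* = {y | U belongs to the ultrafilter of y}, U open. This sY
   is extremally disconnected and zero-dimensional, and as U is included in U*
   it has the cellularity of Y. However, if X is not regular, the pi-weight of
   sX can be smaller than that of X. One therefore takes Y to be the sum of X
   and of a dense subspace D of 2^J, where J is a pi-base of X of least
   cardinality: since J is a family of subsets of X, the
   Hewitt-Marczewski-Pondiczery theorem allows |D| <= |X|; moreover D is ccc,
   and every pi-base of sY needs |J| members on the part coming from D.
   An extremally disconnected Hausdorff space has no injective convergent
   sequence, so for selective high divergence it suffices to choose the x_n
   pairwise distinct. *)
From HB Require Import structures.
Require Import Defs.
From mathcomp Require Import all_boot all_classical.
From mathcomp Require Import topology.

Set Implicit Arguments.
Unset Strict Implicit.
Unset Printing Implicit Defensive.

Local Open Scope classical_set_scope.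
Local Open Scope card_scope.

(** * Infinite cardinals *)

Lemma card_le_injP T U (A : set T) (B : set U) :
  A #<= B <-> exists f : A -> B, injective f.
Proof.
split=> [/card_leP[f]|[f finj]]; first by exists f; apply: in2TT inj.
by apply/card_leP/injfunPex; exists f => // x y _ _; exact: finj.
Qed.

Lemma card_leT_injP T U :
  [set: T] #<= [set: U] <-> exists f : T -> U, injective f.
Proof.
split=> [/card_le_injP[f finj]|[f finj]].
  exists (fun x => val (f (SigSub (mem_set (I : [set: T] x))))).
  by move=> x y /val_inj/finj [].
apply/card_leP/injfunPex.
exists (fun x => SigSub (mem_set (I : [set: U] (f (val x))))) => //.
by move=> x y _ _ [] /finj/val_inj.
Qed.

(* A maximal set of pairwise everywhere different choice functions exhausts
   one of the [T i]. *)
Lemma card_le_min (I : Type) (i0 : I) (T : I -> Type) :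
  exists i, forall j, [set: T i] #<= [set: T j].
Proof.
pose P (G : set (forall i, T i)) :=
  forall f g, G f -> G g -> forall i, f i = g i -> f = g.
have [F FP totF|G [GP maxG]] := @Zorn_bigcup _ P.
  move=> f g [X FX Xf] [Y FY Yg]; have [XY|YX] := totF _ _ FX FY.
    by apply: (FP Y) => //; exact: XY.
  by apply: (FP X) => //; exact: YX.
have [i surj_i] : exists i, forall y : T i, exists f, G f /\ f i = y.
  apply: contrapT => /forallNP nsurj.
  have missed i : {y : T i | forall f, G f -> f i <> y}.
    apply: cid; have /existsNP[y /forallNP yP] := nsurj i.
    by exists y => f Gf fy; apply: (yP f).
  pose f0 i := sval (missed i); have f0P i := svalP (missed i).
  (* [f0] differs at every index from every member of [G], so adding it preserves [P]; the index
     [i0] shows that [f0] is not already in [G]. *)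
  apply: (maxG (G `|` [set f0])).
    split; first by left.
    by move=> /(_ f0 (or_intror erefl)) /f0P-/(_ i0).
  move=> f g [Gf|->] [Gg|->] i fg //; first exact: GP fg.
  - by case: (f0P i f Gf).
  - by case: (f0P i g Gg).
have [h hP] := choice surj_i.
exists i => j; apply/card_leT_injP; exists (fun y => h y j) => y y' hyy'.
by rewrite -(hP y).2 -(hP y').2; rewrite (GP _ _ (hP y).1 (hP y').1 j hyy').
Qed.

Lemma card_le_total T U : [set: T] #<= [set: U] \/ [set: U] #<= [set: T].
Proof.
have [[] H] := card_le_min true (fun b : bool => if b then T else U).
  by left; exact: (H false).
by right; exact: (H true).
Qed.

(** * Finite sequences over an infinite set *)

Section seq.
Variable T : eqType.

Let supp (G : set (seq T * T)) : set T :=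
  [set x | exists s y, G (s, y) /\ x \in s].

(* [G] is the graph of an injection into [supp G], defined on the nonempty
   lists over [supp G]; thus [supp G] is empty or infinite. *)
Let good (G : set (seq T * T)) :=
  [/\ forall s y z, G (s, y) -> G (s, z) -> y = z,
      forall s t y, G (s, y) -> G (t, y) -> s = t,
      forall s y, G (s, y) -> supp G y &
      forall x s, (forall z, z \in x :: s -> supp G z) ->
        exists y, G (x :: s, y)].

Let good_bigcup F : F `<=` good -> total_on F subset ->
  good (\bigcup_(G in F) G).
Proof.
move=> Fgood totF.
have common G H : F G -> F H -> exists2 K, F K & G `<=` K /\ H `<=` K.
  move=> FG FH; have [GH|HG] := totF _ _ FG FH.
    by exists H => //; split.
  by exists G => //; split.
have suppS G H : G `<=` H -> supp G `<=` supp H.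
  by move=> GH x [s [y [/GH Hsy xs]]]; exists s, y.
split.
- move=> s y z [G FG Gsy] [H FH Hsz]; have [K FK [GK HK]] := common _ _ FG FH.
  by have [Kf _ _ _] := Fgood _ FK; apply: Kf (GK _ Gsy) (HK _ Hsz).
- move=> s t y [G FG Gsy] [H FH Hsz]; have [K FK [GK HK]] := common _ _ FG FH.
  by have [_ Ki _ _] := Fgood _ FK; apply: Ki (GK _ Gsy) (HK _ Hsz).
- move=> s y [G FG Gsy]; have [_ _ Gr _] := Fgood _ FG.
  by apply: suppS (Gr _ _ Gsy); exact: bigcup_sup.
- move=> x s sF.
  (* By induction on the list, one member of the chain has all the letters in its support. *)
  have [G FG sG] : exists2 G, F G & forall z, z \in x :: s -> supp G z.
    elim: s sF => [|y s IH] sF.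
      have [t [z [[G FG Gtz] xt]]] := sF x (mem_head _ _).
      by exists G => // w; rewrite inE => /eqP ->; exists t, z.
    have [|G FG GP] := IH.
      by move=> z; rewrite inE => /orP[/eqP ->|zs]; apply: sF;
         rewrite !inE ?eqxx ?zs ?orbT.
    have [t [z [[H FH Htz] yt]]] := sF y ltac:(by rewrite !inE eqxx orbT).
    have [K FK [GK HK]] := common _ _ FG FH.
    exists K => // w; rewrite !inE => /or3P[/eqP ->|/eqP ->|ws].
    + by apply: suppS (GP _ _); rewrite ?mem_head.
    + by exists t, z; split => //; exact: HK.
    + by apply: suppS (GP _ _); rewrite // inE ws orbT.
  have [_ _ _ Gd] := Fgood _ FG; have [y Gy] := Gd _ _ sG.
  by exists y; exists G.
Qed.

(** Letters of [A] become lists of length one and the others lists of length two, so the cases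
    cannot collide; [g] codes first each letter, then the whole list. *)
Let merge_inj (A B : set T) C (g : seq C -> C) (a b : T -> C) :
  injective g -> {in A &, injective a} -> {in B &, injective b} ->
  exists e : seq T -> C, {in [pred s | all [in A `|` B] s] &, injective e}.
Proof.
move=> ginj ainj binj.
pose e x := if x \in A then g [:: a x] else g [:: b x; b x].
have einj : {in A `|` B &, injective e}.
  move=> x y; rewrite !in_setU /e.
  case: ifPn => xA; case: ifPn => yA //= xB yB /ginj // => -[].
    exact: ainj.
  by move=> bxy _; exact: binj.
by exists (g \o map e) => s t sAB tAB /ginj; exact: (inj_in_map einj).
Qed.

(** A maximal [good] graph [G] injects the nonempty lists over [A = supp G] into [A]. If the
    complement of [A] had room for a copy of [A] (of [nat], if [A] is empty), [G] could be enlarged;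
    so the complement injects into [A], and [merge_inj] codes all lists over [T]. *)
Lemma card_seq_eqType : infinite_set [set: T] -> [set: seq T] #<= [set: T].
Proof.
move=> Tinf; have [G [[Gf Gi Gr Gd] Gmax]] := Zorn_bigcup good_bigcup.
pose A := supp G.
have extend (C : Type) (g : seq C -> C) (a : T -> C) (b : C -> T) :
    injective g -> {in A &, injective a} -> injective b ->
    (forall c, ~ A (b c)) -> False.
  move=> ginj ainj binj bNA; pose B := range b.
  have [b' b'K] : exists b' : T -> C, cancel b b'.
    suff /choice[b' b'P] : forall x, exists c, forall d, x = b d -> c = d.
      by exists b' => c; exact: b'P.
    move=> x; have [[c ->]|xB] := pselect (exists c, x = b c).
      by exists c => d /binj.
    by exists (g [::]) => d xd; case: xB; exists d.
  have b'inj : {in B &, injective b'}.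
    by move=> x y /set_mem[c _ <-] /set_mem[d _ <-]; rewrite !b'K => ->.
  have [e einj] := merge_inj ginj ainj b'inj.
  (* Lists over the enlarged support with a letter outside [A] take their values in the range of
     [b], which misses [A], so they cannot clash with the values of [G]. *)
  pose N : set (seq T * T) :=
    [set p | [/\ all [in A `|` B] p.1, ~~ all [in A] p.1 & p.2 = b (e p.1)]].
  have suppN : supp (G `|` N) = A `|` B.
    apply/seteqP; split => x.
      move=> [s [y [[Gsy|[/= sAB _ _]] xs]]]; first by left; exists s, y.
      by have := allP sAB _ xs; rewrite inE.
    move=> [[s [y [Gsy xs]]]|[c _ <-]]; first by exists s, y; split => //; left.
    exists [:: b c], (b (e [:: b c])); rewrite mem_head; split => //; right.
    split => //=; rewrite !andbT; first by rewrite inE; right; exists c.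
    by apply/negP => /set_mem; exact: bNA.
  have GA s y : G (s, y) -> all [in A] s.
    by move=> Gsy; apply/allP => x xs; rewrite inE; exists s, y.
  apply: (Gmax (G `|` N)).
    split; first by left.
    move=> GN; have [s [y [Gsy xs]]] : supp (G `|` N) (b (g [::])).
      by rewrite suppN; right; exists (g [::]).
    apply: (bNA (g [::])); exists s, y; split => //.
    by case: Gsy => // Nsy; apply: GN; right.
  split.
  - move=> s y z [Gsy|[/= _ sA ->]] [Gsz|[/= _ sA' ->]] //.
    + exact: Gf Gsy Gsz.
    + by rewrite (GA _ _ Gsy) in sA'.
    + by rewrite (GA _ _ Gsz) in sA.
  - move=> s t y [Gsy|[/= sAB sA ->]] [Gty|[/= tAB tA]].
    + exact: Gi Gsy Gty.
    + by move=> yE; case: (bNA (e t)); rewrite -yE; apply: Gr Gsy.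
    + by case: (bNA (e s)); apply: Gr Gty.
    + by move=> /binj; exact: einj.
  - move=> s y [Gsy|[/= _ _ ->]]; rewrite suppN; first by left; exact: Gr Gsy.
    by right; exists (e s).
  - move=> x s; rewrite suppN => sAB.
    have [sA|sA] := boolP (all [in A] (x :: s)).
      have [|y Gy] := Gd x s; last by exists y; left.
      by move=> z zs; have := allP sA _ zs; rewrite inE.
    exists (b (e (x :: s))); right; split => //.
    by apply/allP => z zs; rewrite inE; exact: sAB.
have [[x0 Ax0]|A0] := pselect (A !=set0); last first.
  have /card_leT_injP[b binj] := (infiniteP _).1 Tinf.
  case: (@extend nat _ (fun=> 0%N) b (pcan_inj (@pickleK (seq nat)))) => //.
  - by move=> x y /set_mem Ax; case: A0; exists x.
  - by move=> c Ac; apply: A0; exists (b c).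
(* The letter [x0] is put in front because [good] provides values on nonempty lists only. *)
have /choice[g gP] : forall s : seq A, exists u : A,
    G (x0 :: map val s, val u).
  move=> s; have [|y Gy] := Gd x0 (map val s).
    move=> z; rewrite inE => /orP[/eqP -> //|/mapP[u _ ->]].
    by have := valP u; rewrite inE.
  by exists (SigSub (mem_set (Gr _ _ Gy))).
have ginj : injective g.
  move=> s t gst; have := gP s; rewrite gst => /(Gi _ _ _ (gP t))[].
  by move=> /(inj_map val_inj).
pose a x := insubd (SigSub (mem_set Ax0) : A) x.
have ainj : {in A &, injective a}.
  by move=> x y xA yA /(congr1 val); rewrite !val_insubd xA yA.
have [/card_leT_injP[b binj]|/card_leT_injP[b binj]] := card_le_total A (~` A).
  case: (@extend A g a (val \o b)) => //; first by move=> x y /val_inj/binj.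
  by move=> c; have := valP (b c); rewrite inE.
pose b' x := if insub x is Some u then b u else a x.
have b'inj : {in ~` A &, injective b'}.
  move=> x y xA yA; rewrite /b'; case: insubP => [u _ ux|]; last by rewrite xA.
  case: insubP => [v _ vx|]; last by rewrite yA.
  by rewrite -ux -vx => /binj ->.
have [e einj] := merge_inj ginj ainj b'inj.
apply/card_leT_injP; exists (val \o e) => s t /val_inj.
by apply: einj; apply/allP => x _; rewrite inE setUv.
Qed.
End seq.

Lemma card_seq T : infinite_set [set: T] -> [set: seq T] #<= [set: T].
Proof. exact: (@card_seq_eqType {classic T}). Qed.

Lemma card_seqS T U : [set: T] #<= [set: U] -> [set: seq T] #<= [set: seq U].
Proof.
move=> /card_leT_injP[f finj]; apply/card_leT_injP; exists (map f).
exact: inj_map.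
Qed.

(** * Sums, products and suprema of infinite cardinals *)

Lemma card_sum_le T A B : infinite_set [set: T] ->
  [set: A] #<= [set: T] -> [set: B] #<= [set: T] -> [set: A + B] #<= [set: T].
Proof.
move=> Tinf /card_leT_injP[f finj] /card_leT_injP[g ginj].
apply: card_le_trans (card_seq Tinf); apply/card_leT_injP.
exists (fun x => match x with inl a => [:: f a] | inr b => [:: g b; g b] end).
by move=> [a|b] [a'|b'] // [] => [/finj|/ginj] ->.
Qed.

Lemma card_prod_le T A B : infinite_set [set: T] ->
  [set: A] #<= [set: T] -> [set: B] #<= [set: T] -> [set: A * B] #<= [set: T].
Proof.
move=> Tinf /card_leT_injP[f finj] /card_leT_injP[g ginj].
apply: card_le_trans (card_seq Tinf); apply/card_leT_injP.
by exists (fun x => [:: f x.1; g x.2]) => -[a b] [a' b'] [] /finj -> /ginj ->.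
Qed.

Lemma card_seq_le T A : infinite_set [set: T] ->
  [set: A] #<= [set: T] -> [set: seq A] #<= [set: T].
Proof.
by move=> Tinf AT; apply: card_le_trans (card_seq Tinf); exact: card_seqS.
Qed.

Lemma card_setU_le T U (A B : set U) : infinite_set [set: T] ->
  A #<= [set: T] -> B #<= [set: T] -> A `|` B #<= [set: T].
Proof.
move=> Tinf AT BT.
have sumT : [set: (A + B)%type] #<= [set: T].
  by apply: card_sum_le => //; rewrite (card_le_eql (card_setT _)).
apply: card_le_trans sumT.
pose f (x : A + B) := match x with inl a => val a | inr b => val b end.
apply: card_le_trans (card_image_le f setT); apply: subset_card_le => x.
by move=> [xA|xB]; [exists (inl (SigSub (mem_set xA)))
                   |exists (inr (SigSub (mem_set xB)))].
Qed.

(** [card_le_min] works over a fixed index type, here the upper bounds among the subsets of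
    [T + nat]. Any other bound is either above their minimum or equipotent to such a subset. *)
Lemma infinite_card_sup_ex T (F : set (set T)) :
  exists K : Type, infinite_card_sup F K.
Proof.
pose U := (T + nat)%type.
have ubU : infinite_card_ub F U.
  split; first by apply/card_leT_injP; exists inr => m n [].
  move=> A FA; apply: card_le_trans (card_leT A) _.
  by apply/card_leT_injP; exists inl => x y [].
pose ub (S : set U) := infinite_card_ub F S.
have ubT : infinite_card_ub F [set: U].
  split; first by rewrite (card_le_eqr (card_setT _)); exact: ubU.1.
  by move=> A FA; rewrite (card_le_eqr (card_setT _)); exact: ubU.2.
have [[S ubS] Smin] := card_le_min (exist ub _ ubT) (fun S => sval S).
exists S; split => // L [natL ubL].
have [//|/card_leT_injP[f finj]] := card_le_total S L.
pose R : set U := range (val \o f).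
have fL : [set: R] #= [set: L].
  apply: card_eq_trans (card_setT _) _.
  by apply: inj_card_eq => x y _ _ /val_inj; exact: finj.
suff ubf : ub R.
  by have := Smin (exist ub _ ubf); rewrite (card_le_eqr fL).
by split=> [|A FA]; rewrite (card_le_eqr fL); [exact: natL|exact: ubL].
Qed.

(** * Dense subspaces of the absolute *)

(** Neighbourhoods of [y] meet dense open sets, and both classes are closed under finite
    intersections, so together they generate a proper filter. *)
Lemma ultrafilter_at (Y : topologicalType) (y : Y) : exists G : set_system Y,
  [/\ UltraFilter G, nbhs y `<=` G & forall U, open U -> dense U -> G U].
Proof.
pose D := [set P : set Y * set Y | [/\ nbhs y P.1, open P.2 & dense P.2]].
have DT : D (setT, setT).
  by split; [exact: filterT|exact: openT|move=> O [z Oz] _; exists z].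
have FD : ProperFilter (filter_from D (fun P => P.1 `&` P.2)).
  apply: filter_from_proper; last first.
    move=> P [/=]; rewrite nbhsE => -[O [Oop Oy] OP] _ dP.
    have [z [Oz Pz]] := dP O (ex_intro _ y Oy) Oop.
    by exists z; split => //; exact: OP.
  apply: filter_from_filter; first by exists (setT, setT).
  move=> P Q [yP oP dP] [yQ oQ dQ]; exists (P.1 `&` Q.1, P.2 `&` Q.2).
    by split; [exact: filterI|exact: openI|exact: denseI].
  by move=> z [[Pz Qz] [Pz' Qz']].
have [G [GU FG]] := ultraFilterLemma FD.
exists G; split => // U.
  by move=> yU; apply: FG; exists (U, setT); [case: DT|move=> z []].
by move=> oU dU; apply: FG; exists (setT, U); [case: DT|move=> z []].
Qed.

Section star.
Variable Y : topologicalType.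
Implicit Types (U V : set Y) (y : Y).

Definition ultra_at y : set_system Y := sval (cid (ultrafilter_at y)).

#[local] Instance ultra_at_ultra y : UltraFilter (ultra_at y).
Proof. by rewrite /ultra_at; case: cid => ? []. Qed.

Lemma ultra_at_nbhs y : nbhs y `<=` ultra_at y.
Proof. by rewrite /ultra_at; case: cid => ? []. Qed.

Lemma ultra_at_dense y U : open U -> dense U -> ultra_at y U.
Proof. by rewrite /ultra_at; case: cid => ? [? ?]; apply. Qed.

Definition star U : set Y := [set y | ultra_at y U].

Lemma starI U V : star (U `&` V) = star U `&` star V.
Proof.
apply/seteqP; split=> y /=; last by move=> [yU yV]; exact: filterI.
by move=> yUV; split; apply: filterS yUV => z [].
Qed.

Lemma starS U V : U `<=` V -> star U `<=` star V.
Proof. by move=> UV y; exact: filterS. Qed.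

Lemma sub_star U : open U -> U `<=` star U.
Proof. by move=> oU y Uy; apply: ultra_at_nbhs; exact: open_nbhs_nbhs. Qed.

Lemma star_nonempty U y : star U y -> U !=set0.
Proof. exact: (@filter_ex _ (ultra_at y)). Qed.

Lemma star_meets U V : star U `&` star V !=set0 -> U `&` V !=set0.
Proof. by rewrite -starI => -[y /star_nonempty]. Qed.

(** The union of [U] and the complement of its closure is open and dense, hence in every
    [ultra_at y]; an ultrafilter containing this union but not [U] contains the second part. *)
Lemma starC U : open U -> ~` star U = star (~` closure U).
Proof.
move=> oU; have oC : open (~` closure U).
  by rewrite openC; exact: closed_closure.
apply/seteqP; split=> y /=; last first.
  move=> yC yU; have [|z [Cz Uz]] := @star_meets (~` closure U) U.
    by exists y.
  by apply: Cz; exact: subset_closure.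
move=> NyU; have /filterI : ultra_at y (U `|` ~` closure U).
  apply: ultra_at_dense; first exact: openU.
  move=> O [z Oz] oO; have [[w [Ow Uw]]|NOU] := pselect (O `&` U !=set0).
    by exists w; split=> //; left.
  exists z; split=> //; right=> /(_ O) [|w [Uw Ow]].
    exact: open_nbhs_nbhs.
  by apply: NOU; exists w.
have [//|yNU] := in_ultra_setVsetC U (ultra_at_ultra y).
by move=> /(_ _ yNU); apply: filterS => z [[]].
Qed.

End star.

(* The points of [Y], topologized as a dense subspace of the absolute of [Y]:
   [y] is identified with the trace of [ultra_at y] on the open sets. *)
Definition absolute_section (Y : topologicalType) : Type := Y.

Section section_topology.
Variable Y : topologicalType.

HB.instance Definition _ := Choice.on (absolute_section Y).

Let op : set_system (absolute_section Y) := [set W | forall y, W y ->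
  exists U : set Y, [/\ open U, star U y & star U `<=` W]].

Let opT : op setT.
Proof.
move=> y _; exists setT; split=> //; first exact: openT.
exact: (sub_star openT).
Qed.

Let opI : setI_closed op.
Proof.
move=> A B oA oB y [/oA[U [oU yU UA]] /oB[V [oV yV VB]]].
exists (U `&` V); rewrite starI; split=> //; first exact: openI.
by move=> z [/UA Az /VB Bz].
Qed.

Let op_bigU (I : Type) (f : I -> set (absolute_section Y)) :
  (forall i, op (f i)) -> op (\bigcup_i f i).
Proof.
move=> of_ y [i _ /of_[U [oU yU Uf]]]; exists U; split=> //.
by move=> z /Uf fz; exists i.
Qed.

HB.instance Definition _ :=
  isOpenTopological.Build (absolute_section Y) opT opI op_bigU.

Lemma section_openP (W : set (absolute_section Y)) : open W <->
  forall y, W y -> exists U : set Y, [/\ open U, star U y & star U `<=` W].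
Proof. by []. Qed.

Lemma open_star (U : set Y) :
  open U -> open (star U : set (absolute_section Y)).
Proof. by move=> oU; apply/section_openP => y yU; exists U; split. Qed.

Lemma closed_star (U : set Y) :
  open U -> closed (star U : set (absolute_section Y)).
Proof.
move=> oU; rewrite -openC (_ : ~` _ = star (~` closure U)); last exact: starC.
by apply: open_star; rewrite openC; exact: closed_closure.
Qed.

Lemma clopen_star (U : set Y) :
  open U -> clopen (star U : set (absolute_section Y)).
Proof. by move=> oU; split; [exact: open_star|exact: closed_star]. Qed.

Lemma section_clopen_base : has_clopen_base (absolute_section Y).
Proof.
exists [set W | exists2 U : set Y, open U & W = star U].
  split; first by move=> _ [U oU ->]; exact: open_star.
  move=> y A; rewrite nbhsE => -[W [oW Wy] WA].
  have [U [oU yU UW]] := (section_openP W).1 oW y Wy.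
  by exists (star U); [split => //; exists U|exact: subset_trans WA].
by move=> _ [U oU ->]; exact: clopen_star.
Qed.

(** The closure of [W] is [star U], where [U] is the union of the open [V] with [star V] inside [W]:
    [star U] is clopen and contains [W], and a basic neighbourhood [star V] of a point of [star U]
    meets [W] already in a point of [U] and [V]. *)
Lemma section_extremally_disconnected :
  extremally_disconnected (absolute_section Y).
Proof.
move=> W oW.
pose U := \bigcup_(V in [set V : set Y | open V /\ star V `<=` W]) V.
have oU : open U by apply: bigcup_open => V [].
suff -> : closure W = star U by exact: open_star.
apply/seteqP; split.
  rewrite closureE => y /(_ (star U)); apply; split; first exact: closed_star.
  move=> z /((section_openP W).1 oW)[V [oV zV VW]].
  by apply: starS zV; exact: bigcup_sup.
move=> y yU B; rewrite nbhsE => -[B' [oB' B'y] BB].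
have [V [oV yV VB]] := (section_openP B').1 oB' y B'y.
have [z [[O [oO OW] Oz] Vz]] : U `&` V !=set0.
  by apply: star_meets; exists y.
by exists z; split; [apply/OW/sub_star|apply/BB/VB/sub_star].
Qed.

Lemma section_hausdorff :
  hausdorff_space Y -> hausdorff_space (absolute_section Y).
Proof.
move=> hY x y xy; apply: hY => A B.
rewrite !nbhsE => -[A' [oA A'x] AA] [B' [oB B'y] BB].
have starN (z : Y) (U : set Y) :
    open U -> U z -> nbhs (z : absolute_section Y) (star U).
  move=> oU Uz; apply: open_nbhs_nbhs.
  by split; [exact: open_star|exact: sub_star].
have meet := xy _ _ (starN _ _ oA A'x) (starN _ _ oB B'y).
have [z [/AA Az /BB Bz]] := @star_meets Y _ _ meet.
by exists z.
Qed.

Lemma section_no_isolated_points :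
  no_isolated_points Y -> no_isolated_points (absolute_section Y).
Proof.
move=> perfY; apply/seteqP; split=> // y [_ [W]].
rewrite nbhsE => -[W' [oW' W'y] W'W]; rewrite setIT => WE.
have [U [oU yU UW]] := (section_openP W').1 oW' y W'y.
have Uy : U `<=` [set y].
  by rewrite -WE => z /(sub_star oU)/UW/W'W.
suff : isolated [set: Y] y by rewrite perfY.
have [z Uz] := star_nonempty yU.
split; first by rewrite inE.
exists U; first by apply: open_nbhs_nbhs; split => //; rewrite -(Uy _ Uz).
by rewrite setIT; apply/seteqP; split=> // _ ->; rewrite -(Uy _ Uz).
Qed.

Lemma section_open_sub (W : set (absolute_section Y)) : open W -> W !=set0 ->
  exists U : set Y, [/\ open U, U !=set0 & star U `<=` W].
Proof.
move=> oW [y /((section_openP W).1 oW)[U [oU yU UW]]]; exists U; split=> //.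
exact: star_nonempty yU.
Qed.

End section_topology.

(** * Selective high divergence *)

(** Deleting all points but one from a finite open set would leave an open singleton. *)
Lemma open_infinite (X : topologicalType) (U : set X) :
  hausdorff_space X -> no_isolated_points X -> open U -> U !=set0 ->
  infinite_set U.
Proof.
move=> hX perfX oU [x Ux] finU.
have clUx : closed (U `\ x).
  apply: (accessible_finite_set_closed.1 (hausdorff_accessible hX)).
  exact: finite_setD.
suff : isolated [set: X] x by rewrite perfX.
split; first by rewrite inE.
exists (U `&` ~` (U `\ x)).
  apply: open_nbhs_nbhs; split; last by split => // -[_]; exact.
  by apply: openI => //; rewrite openC.
rewrite setIT; apply/seteqP; split=> [y [Uy Uxy]|_ ->]; last first.
  by split=> // -[_]; exact.
by apply: contrapT => yx; apply: Uxy.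
Qed.

Lemma injective_transversal (T : Type) (U : nat -> set T) :
  (forall n, infinite_set (U n)) ->
  exists2 x : nat -> T, injective x & forall n, U n (x n).
Proof.
elim/Peq : T => T in U *; move=> Uinf.
have [p pP] : exists p : nat * seq T -> T,
    forall ns, U ns.1 (p ns) /\ p ns \notin ns.2.
  suff /choice[p pP] : forall ns : nat * seq T,
      exists x, U ns.1 x /\ x \notin ns.2 by exists p.
  move=> [n s] /=; apply: contrapT => /forallNP NU; apply: (Uinf n).
  apply: sub_finite_set (finite_seq s) => x Ux /=.
  by apply/negPn/negP => xs; apply: (NU x).
(* [L n] lists the values chosen at the indices below [n], which the next choice avoids. *)
pose L := fix L n := if n is m.+1 then p (m, L m) :: L m else [::].
pose x n := p (n, L n).
have xL i j : i < j -> x i \in L j.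
  by elim: j => // j IH; rewrite ltnS leq_eqVlt inE => /orP[/eqP->|/IH ->];
    rewrite ?eqxx ?orbT.
have xN n : x n \notin L n by case: (pP (n, L n)).
exists x; last by move=> n; case: (pP (n, L n)).
move=> i j xij; case: (ltngtP i j) => // /xL.
  by rewrite xij (negPf (xN j)).
by rewrite -xij (negPf (xN i)).
Qed.

(** In the application [P k n] says that term [n] of a sequence lies in the set of index [k];
    infinitely many of the sets are selected, each hit by a late term. *)
Lemma cofinal_subsequence (P : nat -> nat -> Prop) :
  (forall N, exists k n, [/\ N <= k, N <= n & P k n]) ->
  exists2 c : nat -> nat, injective c & forall j, exists2 n, j <= n & P (c j) n.
Proof.
move=> /choice[k kP].
(* Each bound exceeds the previous value, so [c] increases strictly; hence [j <= c j], and the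
   witness [n] is pushed beyond [j]. *)
pose c := fix c j := if j is i.+1 then k (c i).+1 else k 0.
have ck N : N <= k N by have [n []] := kP N.
have homoc : {homo c : i j / i < j}.
  by apply: homo_ltn => [i j l|i /=]; [exact: ltn_trans|exact: ck].
have lec j : j <= c j.
  by elim: j => // j IH; apply: leq_trans (ck (c j).+1); rewrite ltnS.
exists c.
  move=> i j cij; case: (ltngtP i j) => // /homoc; rewrite cij ltnn //.
case=> [|j].
  by have [n [_ _ Pn]] := kP 0; exists n.
have [n [_ cn Pn]] := kP (c j).+1; exists n => //.
by apply: leq_trans cn; rewrite ltnS.
Qed.

(* In a disjoint sequence of clopen sets [V k] that do not contain the limit,
   infinitely many are hit by the sequence; the limit is then in the closure of
   the union of those with an even rank and of those with an odd one. *)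
Lemma extremally_disconnected_not_cvg (X : topologicalType) (y : nat -> X)
    (l : X) :
  extremally_disconnected X -> has_clopen_base X -> hausdorff_space X ->
  injective y -> ~ (y n @[n --> \oo] --> l).
Proof.
move=> edX [B [Bop Bbase] Bclopen] hX yinj yl.
have /choice[W WP] : forall n, exists W : set X,
    [/\ clopen W, ~ W l & y n <> l -> W (y n)].
  move=> n; have [->|/eqP ynl] := pselect (y n = l).
    by exists set0; split=> //; exact: clopen0.
  have [U [oU yU lU]] := hausdorff_accessible hX ynl.
  rewrite !inE in yU lU.
  have [|A [BA Ay] AU] := Bbase (y n) U; first exact: open_nbhs_nbhs.
  by exists A; split; [exact: Bclopen|move=> /AU|].
pose V k := W k `\` \bigcup_(i in `I_k) W i.
have V_ex n : y n <> l -> exists2 k, V k (y n) & forall i, i < k -> ~ W i (y n).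
  move=> ynl; have ex : exists k, `[< W k (y n) >].
    by exists n; apply/asboolP; case: (WP n) => _ _; exact.
  case: (ex_minnP ex) => k /asboolP Wk kmin; exists k; last first.
    by move=> i ik /asboolP/kmin; rewrite leqNgt ik.
  by split=> // -[i /= ik /asboolP/kmin]; rewrite leqNgt ik.
have clopen_bigcup k : clopen (\bigcup_(i in `I_k) W i).
  rewrite bigcup_mkord; elim/big_ind: _ => [|A C|i _].
  - exact: clopen0.
  - exact: clopenU.
  - by case: (WP i).
have openV k : open (V k).
  rewrite /V setDE; have [[oW _ _] [_ cW]] := (WP k, clopen_bigcup k).
  by apply: openI; [exact: oW.1|rewrite openC].
have Vdisj i j z : V i z -> V j z -> i = j.
  move=> [Wi Ni] [Wj Nj]; case: (ltngtP i j) => // ij.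
    by case: Nj; exists i.
  by case: Ni; exists j.
have [N|c cinj cP] := @cofinal_subsequence (fun k n => V k (y n)).
  (* The first [N] sets can be removed from a neighbourhood of [l], so late terms different from [l]
     lie in some [V k] with [N <= k]. *)
  have lN : nbhs l (~` \bigcup_(i in `I_N) W i).
    apply: open_nbhs_nbhs; split.
      by rewrite openC; case: (clopen_bigcup N).
    by move=> [i _ Wil]; case: (WP i).
  have [M _ MP] := yl _ lN.
  (* By injectivity at most one term equals [l], so [N + M] or its successor will do. *)
  have [n [Nn Mn ynl]] : exists n, [/\ N <= n, M <= n & y n <> l].
    have [ynl|ynl] := pselect (y (N + M) = l); last first.
      by exists (N + M); rewrite leq_addr leq_addl.
    exists (N + M).+1; rewrite !leqW ?leq_addr ?leq_addl//; split=> //.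
    by rewrite -ynl => /yinj/eqP; rewrite eqn_leq ltnn.
  have [k Vk kmin] := V_ex n ynl; exists k, n; split=> //.
  rewrite leqNgt; apply/negP => kN.
  by case: (MP n Mn); exists k => //; case: Vk.
pose O b := \bigcup_(j in [set j | odd j = b]) V (c j).
have oO b : open (O b) by apply: bigcup_open.
have lO b : closure (O b) l.
  (* The index [2M + b] has parity [b] and is at least [M]. *)
  move=> A /yl[M _ MA]; pose j := (M.*2 + b)%N.
  have [n jn Vn] := cP j; exists (y n); split.
    by exists j => //=; rewrite oddD odd_double oddb.
  by apply: MA => /=; apply: leq_trans jn; rewrite /j -addnn -addnA leq_addr.
(* The closure of [O true] is open, so it meets [O false]; as [O false] is open, it then meets
   [O true] itself, against disjointness. *)
have nl : nbhs l (closure (O true)).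
  by apply: open_nbhs_nbhs; split; [exact: edX|exact: lO].
have [z [Oz zT]] := lO false _ nl.
have [|w [[i iT Vi] [j jF Vj]]] := zT (O false); first exact: open_nbhs_nbhs.
by move: iT jF; rewrite /= (cinj _ _ (Vdisj _ _ _ Vi Vj)) => ->.
Qed.

Lemma extremally_disconnected_SHD (X : topologicalType) :
  extremally_disconnected X -> has_clopen_base X -> hausdorff_space X ->
  no_isolated_points X -> selectively_highly_divergent X.
Proof.
move=> edX baseX hX perfX U UP.
have [x xinj xU] : exists2 x : nat -> X, injective x & forall n, U n (x n).
  apply: injective_transversal => n; have [oU U0] := UP n.
  exact: open_infinite.
exists x; split=> // -[f [homof [l]]].
apply: (extremally_disconnected_not_cvg edX baseX hX) => i j /xinj fij.
by case: (ltngtP i j) => // /homof; rewrite fij ltnn.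
Qed.

(** * Sums with a dense subspace of a Cantor cube *)

(** One point from each member of a finite pi-base would give a finite set whose complement is open
    and nonempty but contains no member. *)
Lemma pi_base_infinite (X : topologicalType) (B : set (set X)) :
  hausdorff_space X -> no_isolated_points X -> [set: X] !=set0 ->
  pi_base B -> infinite_set B.
Proof.
move=> hX perfX X0 [Bop Bpi] finB.
have /choice[p pP] : forall U : set X, exists x, B U -> U x.
  move=> U; have [/Bop[_ [x Ux]]|NBU] := pselect (B U); first by exists x.
  by have [x _] := X0; exists x.
have finp : finite_set (p @` B) by exact: finite_image.
have [||U BU Up] := Bpi (~` (p @` B)).
- rewrite openC.
  exact: (accessible_finite_set_closed.1 (hausdorff_accessible hX)).
- apply: contrapT => /nonemptyPn pT; apply: (open_infinite hX perfX openT X0).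
  apply: sub_finite_set finp => x _; apply: contrapT => px.
  by rewrite -[False]/(set0 x) -pT.
- by apply: (Up (p U) (pP U BU)); exists U.
Qed.

(* All members of [C] disagree with a fixed one in one of its finitely many
   coordinates, which can then be removed from their supports. *)
Lemma incompatible_cylinders_finite (J : eqType) (T : Type) (C : set T)
    (d : T -> J -> bool) (l : T -> seq J) n :
  (forall t, C t -> size (l t) <= n) ->
  (forall s t, C s -> C t -> s <> t ->
     exists j, [/\ j \in l s, j \in l t & d s j != d t j]) ->
  finite_set C.
Proof.
elim: n C l => [|n IH] C l ln sep;
  have [[t0 Ct0]|/nonemptyPn->//] := pselect (C !=set0).
  apply: sub_finite_set (finite_set1 t0) => t Ct; apply: contrapT => tt0.
  have [j [+ _ _]] := sep _ _ Ct Ct0 tt0.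
  by move: (ln t Ct); rewrite leqn0 size_eq0 => /eqP ->.
pose Cj j := [set t | [/\ C t, j \in l t & d t j != d t0 j]].
have finCj j : finite_set (Cj j).
  apply: (IH _ (fun t => [seq i <- l t | i != j])).
    move=> t [Ct jt _]; rewrite -ltnS; apply: leq_trans (ln t Ct).
    rewrite size_filter -(count_predC (fun i => i != j)).
    rewrite -[ltnLHS]addn0 ltn_add2l.
    by rewrite -has_count; apply/hasP; exists j => //=; rewrite negbK.
  move=> s t [Cs _ sj] [Ct _ tj] st; have [i [is_ it sit]] := sep _ _ Cs Ct st.
  (* Both [s] and [t] differ from [t0] at [j]; there being only two values, they agree at [j]. *)
  have ij : i != j.
    apply: contraNneq sit => ->.
    by case: (d s j) (d t j) (d t0 j) sj tj => [] [] [].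
  by exists i; rewrite !mem_filter /= is_ it ij.
apply: (@sub_finite_set _ _ ([set t0] `|` \bigcup_(j in [set` l t0]) Cj j)).
  move=> t Ct; have [->|tt0] := pselect (t = t0); first by left.
  by right; have [j [jt jt0 dj]] := sep _ _ Ct Ct0 tt0; exists j.
rewrite finite_setU; split; first exact: finite_set1.
by apply: bigcup_finite => //; exact: finite_seq.
Qed.

(** Density in the cube [2^J], whose basic open sets prescribe finitely many coordinates. *)
Definition finitely_dense (J : eqType) (D : set (J -> bool)) :=
  forall (s : seq J) (v : J -> bool), exists2 d, D d & {in s, d =1 v}.

(* [c] is a disjunction of conjunctions of literals [(x, b)], which assert that
   [x] belongs ([b = true]) or does not belong ([b = false]) to [A]. *)
Definition dnf (X : Type) (A : set X) (c : seq (seq (X * bool))) :=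
  has (all (fun p => (p.1 \in A) == p.2)) c.

(** For [j] in [s] a conjunction [cl j] holds of [A j] and of no other [A i] with [i] in [s]; the
    disjunction of those with [v j] true takes the values of [v] on [s]. *)
Lemma dnf_finitely_dense (X : Type) (J : eqType) (A : J -> set X) :
  injective A -> finitely_dense (range (fun c j => dnf (A j) c)).
Proof.
move=> Ainj s v.
pose sat j := all (fun p => (p.1 \in A j) == p.2).
have /choice[cl clP] : forall j, exists k, sat j k /\
    {in s, forall i, i != j -> ~~ sat i k}.
  move=> j; elim: s => [|i s [k [jk kP]]]; first by exists [::].
  have [->|ij] := eqVneq i j.
    exists k; split=> // i'; rewrite inE => /orP[/eqP ->|].
      by rewrite eqxx.
    exact: kP.
  have [x xij] : exists x, (x \in A i) != (x \in A j).
    apply: contrapT => /forallNP xij; case/negP: ij; apply/eqP/Ainj/seteqP.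
    by split=> x Ax; have /negP := xij x; rewrite negbK (mem_set Ax);
       move=> /eqP; [move=> /esym|]; move/set_mem.
  exists ((x, x \in A j) :: k); rewrite /sat /= eqxx; split=> // i'.
  rewrite inE => /orP[/eqP ->|i's] i'j; first by rewrite (negPf xij).
  by rewrite negb_and; apply/orP; right; exact: kP.
exists (fun j => dnf (A j) [seq cl i | i <- s & v i]); first by eexists.
move=> i si; rewrite /dnf has_map; apply/hasP/idP => [[j]|vi].
  rewrite mem_filter => /andP[vj sj] /= ji; have [<-//|ij] := eqVneq j i.
  have [_ /(_ i si)] := clP j; rewrite eq_sym => /(_ ij).
  by rewrite /sat ji.
by exists i; [rewrite mem_filter vi|case: (clP i)].
Qed.

(* The topological sum of [X] and of [D], a subspace of the power of the
   discrete space [bool]. *)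
Definition cantor_sum (X : Type) (J : eqType) (D : set (J -> bool)) : Type :=
  (X + D)%type.

Section cantor_sum.
Variables (X : topologicalType) (J : eqType) (D : set (J -> bool)).
Local Notation Y := (cantor_sum X D).

HB.instance Definition _ := gen_eqMixin Y.
HB.instance Definition _ := gen_choiceMixin Y.

Definition cylinder (s : seq J) (v : J -> bool) : set D :=
  [set d | {in s, val d =1 v}].

Let op : set_system Y := [set O | open [set x | O (inl x)] /\
  forall d, O (inr d) -> exists s, forall e, cylinder s (val d) e -> O (inr e)].

Let opT : op setT.
Proof. by split=> [|d _]; [exact: openT|exists [::]]. Qed.

Let opI : setI_closed op.
Proof.
move=> A B [oA AP] [oB BP]; split; first exact: openI.
move=> d [/AP[s sA] /BP[t tB]]; exists (s ++ t) => e ed; split.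
  by apply: sA => j js; apply: ed; rewrite mem_cat js.
by apply: tB => j js; apply: ed; rewrite mem_cat js orbT.
Qed.

Let op_bigU (I : Type) (f : I -> set Y) : (forall i, op (f i)) ->
  op (\bigcup_i f i).
Proof.
move=> fop; split.
  rewrite [X in open X](_ : _ = \bigcup_i [set x | f i (inl x)]) //.
  by apply: bigcup_open => i _; case: (fop i).
move=> d [i _ fid]; have [_ /(_ _ fid)[s sP]] := fop i.
by exists s => e /sP; exists i.
Qed.

HB.instance Definition _ := isOpenTopological.Build Y opT opI op_bigU.

Lemma cantor_sum_openP (O : set Y) : open O <-> open [set x | O (inl x)] /\
  forall d, O (inr d) -> exists s, forall e, cylinder s (val d) e -> O (inr e).
Proof. by []. Qed.

Lemma open_inl (U : set X) : open U -> open (inl @` U : set Y).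
Proof.
move=> oU; apply/cantor_sum_openP; split=> [|d []//].
rewrite (_ : mkset _ = U) //; apply/seteqP; split=> [x [y Uy [<-]]//|x Ux].
by exists x.
Qed.

Lemma open_cylinder s v : open (inr @` cylinder s v : set Y).
Proof.
apply/cantor_sum_openP; split.
  by rewrite (_ : mkset _ = set0); [exact: open0|apply/seteqP; split=> // x []].
move=> d [d' dP [<-]]; exists s => e ed; exists e => // j js.
by rewrite ed ?dP.
Qed.

Lemma cantor_sum_cases (O : set Y) : open O -> O !=set0 ->
  [set x | O (inl x)] !=set0 \/
  exists s (d : D), inr @` cylinder s (val d) `<=` O.
Proof.
move=> oO; have [_ OP] := (cantor_sum_openP _).1 oO.
move=> [y Oy]; case: y Oy => [x|d] Oy; first by left; exists x.
right; have [s sP] := OP _ Oy; exists s, d => z [e /sP Oe <-] //.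
Qed.

Lemma cantor_sum_hausdorff : hausdorff_space X -> hausdorff_space Y.
Proof.
move=> hX; have inlN x U : nbhs x U -> nbhs (inl x : Y) (inl @` U).
  rewrite !nbhsE => -[V [oV Vx] VU].
  exists (inl @` V); last exact: image_subset.
  by split; [exact: open_inl|exists x].
have inrN (d : D) s : nbhs (inr d : Y) (inr @` cylinder s (val d)).
  by apply: open_nbhs_nbhs; split; [exact: open_cylinder|exists d => // j].
have T (x : X) : nbhs x [set: X] by apply: filterT.
move=> [x|d] [y|e] xy.
- congr inl; apply: hX => U V /inlN xU /inlN yV.
  have [_ [[z Uz <-] [w Vw [wz]]]] := xy _ _ xU yV.
  by exists z; split=> //; rewrite -wz.
- by have [_ [[z _ <-] []]] := xy _ _ (inlN _ _ (T x)) (inrN e [::]).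
- by have [_ [[z _ <-] []]] := xy _ _ (inrN d [::]) (inlN _ _ (T y)).
- congr inr; apply/val_inj/funext => j.
  have [_ [[z dz <-] [w ew [wz]]]] := xy _ _ (inrN d [:: j]) (inrN e [:: j]).
  by rewrite -dz ?mem_head // -ew ?mem_head // wz.
Qed.

Hypothesis Ddense : finitely_dense D.

Lemma cylinder_nonempty s v : cylinder s v !=set0.
Proof. by have [d Dd dv] := Ddense s v; exists (SigSub (mem_set Dd)). Qed.

Lemma cantor_sum_no_isolated_points : infinite_set [set: J] ->
  no_isolated_points X -> no_isolated_points Y.
Proof.
move=> Jinf perfX; apply/seteqP; split=> // y [_ [V]].
rewrite nbhsE setIT => -[O [oO Oy] OV VE].
have Oy1 z : O z -> z = y by move/OV; rewrite VE.
case: y Oy VE Oy1 => [x|d] Oy _ Oy1.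
  suff : isolated [set: X] x by rewrite perfX.
  split; first by rewrite inE.
  exists [set x | O (inl x)].
    by apply: open_nbhs_nbhs; split => //; exact: ((cantor_sum_openP _).1 oO).1.
  by rewrite setIT; apply/seteqP; split=> [z /Oy1[]//|_ ->].
have [_ /(_ _ Oy)[s sP]] := (cantor_sum_openP _).1 oO.
have [j js] : exists j, j \notin s.
  apply: contrapT => /forallNP sT; apply: Jinf.
  apply: sub_finite_set (finite_seq s).
  by move=> j _ /=; apply/negPn/negP; exact: sT.
(* A second point of the neighbourhood: it agrees with [d] on [s] and differs from it at [j]. *)
have [e eP] := cylinder_nonempty (j :: s)
  (fun i => if i == j then ~~ val d j else val d i).
have /Oy1[ed] : O (inr e).
  apply: sP => i is_; rewrite eP ?inE ?is_ ?orbT //.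
  by case: eqP is_ js => // -> ->.
have := eP j (mem_head _ _); rewrite eqxx ed.
by case: (val d j).
Qed.

(** This is the countable chain condition for [D]: for each [n], only finitely many pairwise
    disjoint cylinders restrict at most [n] coordinates. *)
Lemma cylinders_countable (T : Type) (C : set T) (g : T -> set Y) :
  (forall t, C t -> exists s (d : D), inr @` cylinder s (val d) `<=` g t) ->
  (forall t u, C t -> C u -> t <> u -> g t `&` g u = set0) ->
  countable C.
Proof.
move=> gcyl gdisj.
have /choice[p pP] : forall t, exists p : seq J * D,
    C t -> inr @` cylinder p.1 (val p.2) `<=` g t.
  move=> t; have [/gcyl[s [d sd]]|NCt] := pselect (C t); first by exists (s, d).
  by have [d _] := cylinder_nonempty [::] xpred0; exists ([::], d).
apply: (@sub_countable _ _ _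
    (\bigcup_n [set t | C t /\ size (p t).1 <= n])).
  by apply: subset_card_le => t Ct; exists (size (p t).1).
apply: bigcup_countable => // n _; apply: finite_set_countable.
apply: (@incompatible_cylinders_finite _ _ _ (fun t => val (p t).2)
  (fun t => (p t).1) n) => [t []//|t u [Ct _] [Cu _] tu].
apply: contrapT => /forallNP agree.
(* Two cylinders that agree on their common coordinates share a point of [D]. *)
have [d dP] := cylinder_nonempty ((p t).1 ++ (p u).1)
  (fun j => if j \in (p t).1 then val (p t).2 j else val (p u).2 j).
have : (g t `&` g u) (inr d); last by rewrite gdisj.
split.
  apply: (pP t Ct); exists d => // j jt; rewrite dP ?mem_cat ?jt //.
apply: (pP u Cu); exists d => // j ju; rewrite dP ?mem_cat ?ju ?orbT //.
case: ifPn => // jt; apply/eqP/negPn/negP => tuj.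
by apply: (agree j).
Qed.

(** * Pi-weight and cellularity of the section of the sum *)

Local Notation sY := (absolute_section Y).

Lemma cantor_sum_pi_base (B : set (set X)) : pi_base B -> infinite_set B ->
  [set: J] #<= B -> exists2 B' : set (set sY), pi_base B' & B' #<= B.
Proof.
move=> [Bop Bpi] Binf JB.
(* A list of pairs codes a cylinder: a listed coordinate has value true exactly when it is paired
   with [true], so even inconsistent lists give nonempty cylinders. *)
pose h (i : B + seq (J * bool)) : set Y := match i with
  | inl U => inl @` val U
  | inr s => inr @` cylinder (map fst s) (fun j => (j, true) \in s)
  end.
have oh i : open (h i).
  case: i => [U|s]; last exact: open_cylinder.
  by apply: open_inl; have := valP U; rewrite inE => /Bop[].
exists ((fun i => star (h i) : set sY) @` setT).
  split.
    move=> _ [i _ <-]; split; first exact: open_star.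
    have [y hy] : h i !=set0.
      case: i => [U|s] /=.
        have := valP U; rewrite inE => /Bop[_ [x Ux]].
        by exists (inl x), x.
      have [d ds] := cylinder_nonempty (map fst s) (fun j => (j, true) \in s).
      by exists (inr d), d.
    by exists y; exact: sub_star.
  move=> V oV V0; have [U [oU U0 UV]] := section_open_sub oV V0.
  suff [i iU] : exists i, h i `<=` U.
    exists (star (h i)); first by exists i.
    by apply: subset_trans UV; exact: starS.
  have [UX|[s [d sd]]] := cantor_sum_cases oU U0.
    have [W BW WU] := Bpi _ ((cantor_sum_openP _).1 oU).1 UX.
    by exists (inl (SigSub (mem_set BW))) => _ [x Wx <-]; exact: WU.
  exists (inr [seq (j, val d j) | j <- s]); apply: subset_trans sd.
  apply: image_subset => e ed j js.
  rewrite ed; last first.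
    by apply/mapP; exists (j, val d j) => //; apply/mapP; exists j.
  apply/mapP/idP => [[i _ [-> di]]|dj]; first exact: esym di.
  by exists j => //; congr pair; exact: esym dj.
apply: card_le_trans (card_image_le _ _) _.
have BT : [set: B] #= B := card_setT B.
have BTinf : infinite_set [set: B] by rewrite (eq_finite_set BT).
rewrite -(card_le_eqr BT); apply: card_sum_le => //.
apply: card_seq_le => //; apply: card_prod_le => //.
  by rewrite (card_le_eqr BT).
by apply: card_le_trans ((infiniteP _).1 BTinf); exact: countableP.
Qed.

(** A nonempty open set lies in [star (E true j)] for finitely many [j] only, so choosing a member
    of [B] inside each of these stars is a finite-to-one map from [J] to [B]. *)
Lemma cantor_sum_pi_base_ge (B : set (set sY)) : pi_base B -> infinite_set B ->
  [set: J] #<= B.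
Proof.
move=> [Bop Bpi] Binf; pose E b j : set Y := inr @` cylinder [:: j] (fun=> b).
have oE b j : open (E b j) by exact: open_cylinder.
have /choice[s sP] : forall W : set sY, exists s : seq J,
    B W -> forall j, W `<=` star (E true j) -> j \in s.
  move=> W; have [BW|NBW] := pselect (B W); last by exists [::].
  have [oW W0] := Bop _ BW; have [U [oU U0 UW]] := section_open_sub oW W0.
  have meets j V : open V -> U `&` V !=set0 -> W `<=` star (E true j) ->
      E true j `&` V !=set0.
    move=> oV [y [Uy Vy]] WE; apply: star_meets; exists y.
    by split; [apply/WE/UW|]; exact: sub_star.
  have [[x Ux]|[s [d sd]]] := cantor_sum_cases oU U0.
    exists [::] => _ j /(meets j (range inl) (open_inl openT))[].
      by exists (inl x); split=> //; exists x.
    by move=> _ [[d _ <-] [z _]].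
  (* If the cylinder does not restrict [j], it meets [E false j], which is disjoint from
     [E true j]. *)
  exists s => _ j WE; apply/negPn/negP => js.
  have [e eP] := cylinder_nonempty (j :: s)
    (fun i => if i == j then false else val d i).
  have := meets j (E false j) (oE _ _) _ WE; case.
    exists (inr e); split.
      apply: sd; exists e => // i is_; rewrite eP ?inE ?is_ ?orbT //.
      by case: eqP is_ js => // -> ->.
    by exists e => // i; rewrite inE => /eqP ->; rewrite eP ?mem_head ?eqxx.
  move=> _ [[d1 d1P <-] [d2 d2P [d12]]]; move: (d1P j (mem_head _ _)).
  by rewrite -d12 (d2P j (mem_head _ _)).
have /choice[W WP] : forall j, exists W, B W /\ W `<=` star (E true j).
  move=> j; have [d dj] := cylinder_nonempty [:: j] (fun=> true).
  have [||W BW WE] := Bpi (star (E true j)); first exact: open_star.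
    by exists (inr d); apply: sub_star => //; exists d.
  by exists W.
have BT : [set: B] #= B := card_setT B.
have BTinf : infinite_set [set: B] by rewrite (eq_finite_set BT).
rewrite -(card_le_eqr BT).
have : [set: (B * nat)%type] #<= [set: B].
  by apply: card_prod_le => //; exact/infiniteP.
apply: card_le_trans; apply/card_leT_injP.
(* The position of [j] in the finite list of its chosen member makes the finite-to-one map
   injective. *)
exists (fun j => (SigSub (mem_set (WP j).1), index j (s (W j)))).
move=> i j [Wij]; rewrite -Wij.
have si : i \in s (W i) by apply: sP; case: (WP i).
have sj : j \in s (W i) by rewrite Wij; apply: sP; case: (WP j).
by move=> /(congr1 (nth i (s (W i)))); rewrite !nth_index.
Qed.

(** Comparing upper bounds covers suprema that are not attained. Families of [X] are carried over by
    stars; conversely, a family of [sY] splits into members with a trace on [X] and countably many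
    that contain a cylinder. *)
Lemma cantor_sum_cellularity (L : Type) :
  infinite_card_ub (@cellular_family sY) L <->
  infinite_card_ub (@cellular_family X) L.
Proof.
split=> -[natL ubL]; split=> // C [Cop Cdisj].
  pose f (U : set X) : set sY := star (inl @` U : set Y).
  have fdisj U V : f U `&` f V !=set0 -> U `&` V !=set0.
    move=> /(@star_meets Y)[_ [[x Ux <-] [z Vz [zx]]]].
    by exists x; split=> //; rewrite -zx.
  have f0 U : C U -> f U !=set0.
    move=> /Cop[oU [x Ux]]; exists (inl x).
    apply: sub_star; first exact: open_inl.
    by exists x.
  have finj : {in C &, injective f}.
    move=> U V /set_mem CU /set_mem CV fUV; apply: Cdisj => //.
    by apply: fdisj; rewrite -fUV setIid; exact: f0.
  rewrite -(card_le_eql (inj_card_eq finj)); apply: ubL; split.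
    move=> _ [U CU <-]; split; last exact: f0.
    by apply: open_star; apply: open_inl; case: (Cop U CU).
  move=> _ _ [U CU <-] [V CV <-] /fdisj UV; congr f; exact: Cdisj.
have Linf : infinite_set [set: L] by exact/infiniteP.
(* Shrinking each member to an open set of [Y] keeps the family disjoint. *)
have /choice[g gP] : forall W : set sY, exists U : set Y,
    C W -> [/\ open U, U !=set0 & U `<=` W].
  move=> W; have [/Cop[oW W0]|NCW] := pselect (C W); last by exists set0.
  have [U [oU U0 UW]] := section_open_sub oW W0; exists U => _; split=> //.
  by apply: subset_trans UW; exact: sub_star.
have gdisj V W : C V -> C W -> g V `&` g W !=set0 -> V = W.
  move=> CV CW [y [gVy gWy]]; apply: Cdisj => //; exists y.
  have [[_ _ VV] [_ _ WW]] := (gP V CV, gP W CW).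
  by split; [exact: VV|exact: WW].
pose C1 := [set W | C W /\ [set x | g W (inl x)] !=set0].
pose C2 := [set W | C W /\
  exists s (d : D), inr @` cylinder s (val d) `<=` g W].
have -> : C = C1 `|` C2.
  apply/seteqP; split=> [W CW|W [[]|[]]//]; have [oW W0 _] := gP W CW.
  by have [|] := cantor_sum_cases oW W0; [left|right].
apply: card_setU_le => //; last first.
  apply: card_le_trans natL; apply: (@cylinders_countable _ _ g) => [W []//|].
  move=> V W [CV _] [CW _] VW; apply: contrapT => /eqP/set0P meet.
  by apply: VW; exact: gdisj meet.
pose f (W : set sY) := [set x | g W (inl x)].
have fdisj V W : C1 V -> C1 W -> f V `&` f W !=set0 -> V = W.
  by move=> [CV _] [CW _] [x [Vx Wx]]; apply: gdisj => //; exists (inl x).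
have finj : {in C1 &, injective f}.
  move=> V W /set_mem CV /set_mem CW fVW; apply: fdisj => //.
  by rewrite -fVW setIid; case: CV.
rewrite -(card_le_eql (inj_card_eq finj)); apply: ubL; split.
  move=> _ [W [CW W0] <-]; split=> //.
  by have [/cantor_sum_openP[]] := gP W CW.
by move=> _ _ [V CV <-] [W CW <-] /fdisj VW; congr f; exact: VW.
Qed.

End cantor_sum.

Lemma card_cantor_sum (X : Type) (J : eqType) (A : J -> set X) :
  infinite_set [set: X] ->
  [set: X] #= [set: cantor_sum X (range (fun c j => dnf (A j) c))].
Proof.
move=> Xinf; rewrite card_eq_le; apply/andP; split.
  by apply/card_leT_injP; exists inl => x y [].
apply: card_sum_le => //; rewrite (card_le_eql (card_setT _)).
apply: card_le_trans (card_image_le _ _) _.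
apply: card_seq_le => //; apply: card_seq_le => //; apply: card_prod_le => //.
apply: card_le_trans ((infiniteP _).1 Xinf); exact: countableP.
Qed.

Lemma min_pi_base_ex (X : topologicalType) : exists2 B : set (set X),
  pi_base B & forall B' : set (set X), pi_base B' -> B #<= B'.
Proof.
have pi_open : pi_base [set U : set X | open U /\ U !=set0].
  by split=> // V oV V0; exists V.
have [[B piB] Bmin] := card_le_min (exist (@pi_base X) _ pi_open)
  (fun B => set_type (sval B)).
exists B => // B' piB'; have := Bmin (exist _ B' piB').
by rewrite (card_le_eql (card_setT _)) (card_le_eqr (card_setT _)).
Qed.

Theorem theorem11 (X : topologicalType)
    (hausdorffX : hausdorff_space X) (perfectX : no_isolated_points X) :
  exists sX : topologicalType,
    [/\ extremally_disconnected sX,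
        has_clopen_base sX,
        hausdorff_space sX,
        no_isolated_points sX &
        selectively_highly_divergent sX] /\
    [/\ [set: X] #= [set: sX],
        exists K : Type, is_pi_weight X K /\ is_pi_weight sX K &
        exists K : Type, is_cellularity X K /\ is_cellularity sX K].
Proof.
have [B piB minB] := min_pi_base_ex X.
have [K supK] := infinite_card_sup_ex [set B].
have [L supL] := infinite_card_sup_ex (@cellular_family X).
(* The empty space is its own [sX]: it has no nonempty open set, so every condition is vacuous or
   trivial. *)
have [X0|/set0P X0] := eqVneq [set: X] set0.
  have sub0 (U : set X) : U = set0 by rewrite -subset0 -X0.
  exists X; split; split=> //.
  - by move=> U _; rewrite (sub0 (closure U)); exact: open0.
  - exists [set: set X]; first split=> [U _|x].
    + by rewrite (sub0 U); exact: open0.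
    + by have : [set: X] x by []; rewrite X0.
    + by move=> U _; rewrite (sub0 U); exact: clopen0.
  - by move=> U /(_ 0)[_ []x]; rewrite (sub0 (U 0)).
  - by exists K; split; exists B.
  - by exists L.
have Xinf : infinite_set [set: X].
  exact: (open_infinite hausdorffX perfectX openT X0).
have Binf : infinite_set B by exact: pi_base_infinite piB.
pose J : eqType := {classic B}; pose A : J -> set X := fun U => val (U : B).
have Ainj : injective A by exact: val_inj.
pose D : set (J -> bool) := range (fun c j => dnf (A j) c).
have Ddense : finitely_dense D by exact: dnf_finitely_dense.
have JB : [set: J] #= B := card_setT B.
have Jinf : infinite_set [set: J] by rewrite (eq_finite_set JB).
pose Y : topologicalType := cantor_sum X D.
have hY : hausdorff_space Y by exact: cantor_sum_hausdorff.
have perfY : no_isolated_points Y by exact: cantor_sum_no_isolated_points.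
pose sX : topologicalType := absolute_section Y.
have hsX : hausdorff_space sX by exact: section_hausdorff.
have perfsX : no_isolated_points sX by exact: section_no_isolated_points.
have edsX : extremally_disconnected sX.
  by exact: section_extremally_disconnected.
have basesX : has_clopen_base sX by exact: section_clopen_base.
have XsX : [set: X] #= [set: sX] := card_cantor_sum A Xinf.
exists sX; split; split=> //; first exact: extremally_disconnected_SHD.
  exists K; split; first by exists B.
  have geB (B' : set (set sX)) : pi_base B' -> B #<= B'.
    move=> piB'; rewrite -(card_le_eql JB).
    apply: cantor_sum_pi_base_ge => //; apply: pi_base_infinite piB' => //.
    by have [x _] := X0; exists (inl x).
  have JleB : [set: J] #<= B by move: JB; rewrite card_eq_le => /andP[].
  have [B' piB' B'B] := cantor_sum_pi_base Ddense piB Binf JleB.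
  have BB' : B' #= B by rewrite card_eq_le B'B geB.
  have ubE M : infinite_card_ub [set B'] M <-> infinite_card_ub [set B] M.
    split=> -[natM ubM]; split=> // _ ->.
      by rewrite -(card_le_eql BB'); exact: ubM.
    by rewrite (card_le_eql BB'); exact: ubM.
  exists B'; split=> //.
    by move=> B'' piB''; apply: card_le_trans B'B _; exact: geB.
  by split=> [|M /ubE]; [apply/ubE; case: supK|case: supK => _; apply].
have ubE M := cantor_sum_cellularity X Ddense M.
exists L; split=> //; split=> [|M /ubE]; first by apply/ubE; case: supL.
by case: supL => _; apply.
Qed.
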